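(* Let $c\ge 1$ be a real number. Then there exist a Hilbert space $\mathcal H$, an operator $J$ on $\mathcal H$ with $J=J^*$ and $J^2=I$, and a $J$-unitary operator $\widehat V$ on $\mathcal H$ such that: (a) $r(\widehat V)=r(\widehat V^{-1})=c$; (b) $S(\widehat V,c)=S(\widehat V^{-1},c)=S(\widehat V^{*-1},c)=S(\widehat V^{*},c)=\{0\}$; (c) there exist a maximal strictly positive subspace $\mathcal L_+$ and a maximal strictly negative subspace $\mathcal L_-$ of $\mathcal H$, each invariant under both $\widehat V$ and $\widehat V^{-1}$, such that $\mathcal L_+$ and $\mathcal L_-$ are mutually $J$-orthogonal and $\mathcal L_++\mathcal L_-$ is dense in $\mathcal H$; ($d_1$) if $L_1$ is a non-zero subspace of $\mathcal H$ with $\widehat V L_1\subset L_1$, then $r(\widehat V|L_1)=r(\widehat V)$; ($d_2$) if $L_2$ is a non-zero subspace of $\mathcal H$ with $\widehat V^{-1}L_2\subset L_2$, then $r(\widehat V^{-1}|L_2)=r(\widehat V^{-1})$.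
   Context: Hilbert spaces are over a fixed scalar field, either $\mathbb R$ or $\mathbb C$. ''Subspace'' means closed linear subspace. For a bounded operator $T$, $r(T)$ denotes its spectral radius, $r(T)=\lim_{N\to\infty}\|T^N\|^{1/N}$; $T|L$ is the restriction of $T$ to a $T$-invariant subspace $L$; $T^{*-1}=(T^* )^{-1}$. For a bounded operator $T$ on a Hilbert space $\mathcal H$ and a number $c$, $$S(T,c):=\{x\in \mathcal H \mid \exists M\ge 0\ \forall N\ge 0\ (N \text{ integer}):\ \|T^Nx\|\le Mc^N\}.$$ Given an operator $J$ on $\mathcal H$ with $J=J^*$, $J^2=I$, put $\{x,y\}:=(x,Jy)$, where $(\cdot,\cdot)$ is the inner product of $\mathcal H$. A bounded operator $\widehat V$ with bounded everywhere defined inverse is $J$-unitary if $\{\widehat Vx,\widehat Vy\}=\{x,y\}$ for all $x,y\in\mathcal H$. Two subspaces $L,L'$ are $J$-orthogonal if $\{x,y\}=0$ for all $x\in L$, $y\in L'$. A subspace $L$ is strictly positive (strictly negative) if $\{x,x\}>0$ (respectively $\{x,x\}<0$) for all $x\in L\setminus\{0\}$; it is maximal strictly positive (maximal strictly negative) if it is not properly contained in another strictly positive (respectively strictly negative) subspace. A subspace $L$ is invariant under $\widehat V$ and $\widehat V^{-1}$ if $\widehat VL\subset L$ and $\widehat V^{-1}L\subset L$. *)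

(* Defs.v *)
From HB Require Import structures.
From mathcomp Require Import all_boot all_order all_algebra.
From mathcomp Require Import sesquilinear complex.
From mathcomp Require Import boolp classical_sets reals topology normedtype.
From mathcomp Require Import sequences exp.

Set Implicit Arguments.
Unset Strict Implicit.
Unset Printing Implicit Defensive.

Import Order.TTheory GRing.Theory Num.Theory.
Import numFieldNormedType.Exports.

Local Open Scope classical_set_scope.
Local Open Scope ring_scope.

Variant scalar_kind := RealScalars | ComplexScalars.

Definition scalarField (R : realType) (k : scalar_kind) : numFieldType :=
  match k with RealScalars => R | ComplexScalars => R[i] end.

Definition conj {R : realType} {k : scalar_kind} :
    scalarField R k -> scalarField R k :=
  match k with RealScalars => idfun | ComplexScalars => @conjc R end.

Definition re {R : realType} {k : scalar_kind} : scalarField R k -> R :=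
  match k with RealScalars => idfun | ComplexScalars => @complex.Re R end.

(* The inner product is linear in its first argument and conjugate-linear in
   the second one. *)
Record hilbertSpace (R : realType) (k : scalar_kind) := HilbertSpace {
  hilbert_carrier :> completeNormedModType (scalarField R k) ;
  inner : {dot hilbert_carrier for @conj R k} ;
  inner_norm : forall x, inner x x = `|x| ^+ 2 }.

Section Operators.
Variables (R : realType) (k : scalar_kind) (H : hilbertSpace R k).
Implicit Types (x y z : H) (L : set H) (T : H -> H).

(* `|x| lives in the scalar field, which may be R[i]; nrm x is the same
   (nonnegative) number, seen in R. *)
Definition nrm x : R := re `|x|.

Definition bounded_op T :=
  linear T /\ exists M : R, forall x, nrm (T x) <= M * nrm x.

Definition closed_submod L := submod_closed (mem L) /\ closed L.

Definition invariant_under T L := T @` L `<=` L.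

(* T^* y is the vector z such that (T x, y) = (x, z) for all x; it exists, by
   the Riesz representation theorem, and is unique when T is bounded. *)
Definition adjoint T : H -> H := fun y =>
  xget 0 [set z | forall x, inner H (T x) y = inner H x z].

(* Meaningful for bijective T only. *)
Definition inverse T : H -> H := fun y => xget 0 [set x | T x = y].

(* The operator norm of the restriction T|L. *)
Definition opnorm_on L T : R := sup [set nrm (T x) | x in L `&` [set x | nrm x <= 1]].

(* The spectral radius of T|L for a T-invariant closed_submod L, in which case
   (T|L)^N is the restriction of T^N to L. *)
Definition specradius_on L T : R :=
  lim ((fun N : nat => opnorm_on L (iter N T) `^ N%:R^-1) @ \oo).

Definition specradius T : R := specradius_on setT T.

Definition Sset T (c : R) : set H :=
  [set x | exists2 M : R, 0 <= M &
             forall N : nat, nrm (iter N T x) <= M * c ^+ N].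

Definition Jform (J : H -> H) x y := inner H x (J y).

Definition Junitary (J V : H -> H) :=
  [/\ bounded_op V, bijective V, bounded_op (inverse V) &
      forall x y, Jform J (V x) (V y) = Jform J x y].

Definition Jorthogonal (J : H -> H) L L' :=
  forall x y, L x -> L' y -> Jform J x y = 0.

Definition strictly_positive (J : H -> H) L :=
  closed_submod L /\ forall x, L x -> x != 0 -> 0 < Jform J x x.

Definition strictly_negative (J : H -> H) L :=
  closed_submod L /\ forall x, L x -> x != 0 -> Jform J x x < 0.

Definition maximal_for (P : set H -> Prop) L :=
  P L /\ forall L', P L' -> ~ (L `<` L').

End Operators.

(* Main.v *)
From HB Require Import structures.
Require Import Defs.
From mathcomp Require Import all_boot all_order all_algebra.
From mathcomp Require Import finmap sesquilinear complex ring lra zify.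
From mathcomp Require Import boolp classical_sets functions reals topology normedtype.
From mathcomp Require Import sequences exp summability.

Import Order.TTheory GRing.Theory Num.Theory.
Import numFieldNormedType.Exports.
Local Open Scope classical_set_scope.
Local Open Scope ring_scope.

Set Implicit Arguments.
Unset Strict Implicit.
Unset Printing Implicit Defensive.

(** The space is l2(Z x bool), that is two copies of l2(Z).  Fix a weight
    w : Z -> R, w n > 0, and put rho (n, true) = w n, rho (n, false) = 1 / w n.
    The operator V is the bilateral shift conjugated by rho: on one copy it is
    the weighted shift with weights w (n + 1) / w n, on the other one the shift
    with the inverse weights.  As J exchanges the copies and rho becomes 1 / rho
    under the exchange, V^* = J V^-1 J ([shift_adjoint]), which is
    J-unitarity.  The powers are V^m x (i) = (rho i / rho (i - m)) x (i - m) for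
    every integer m ([iter_shift]), so that all norms are controlled by ratios of
    values of w.

    The weight is w n = g |n|, where g zigzags ([zigzag_weight]).  With the
    envelope E n = c^n (n + 1)^2, each step multiplies g by E (n + 1) / E n or
    divides it by that quotient, and the direction is reversed each time g (or
    1 / g) has reached (n + 1) c^n.  Such a reversal always comes, since a
    monotone run reproduces E up to a constant factor.  So g (n + q) / g n lies
    between 1 / E q and E q, whereas neither g n / c^n nor 1 / (g n c^n) is
    bounded.  The first fact gives ||V^N|| <= E |N| for N in Z.  By the second
    one, the coordinates of V^N x and of V^-N x exceed every multiple of c^N as
    soon as x is not zero: this is S(V, c) = S(V^-1, c) = {0}, and conjugation
    by J carries it over to the adjoints.

    Statements (a), (d1) and (d2) are then one and the same
    ([specradius_onE]).  For an invariant subspace L the sequence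
    b N = ||V^N | L|| / c^N is submultiplicative; were b m < 1 for some m > 0, it
    would be bounded and L would be contained in S(V, c).  Hence
    c^N <= ||V^N | L|| <= E N, and the N-th root of E N tends to c.

    For (c), L+ and L- are the graphs of the possibly unbounded positive diagonal
    operator with entries 1 / (w n)^2 and of its opposite, in the form
    rho (i') x (i) = +- rho (i) x (i'), where i' denotes i with the copies
    exchanged.  They are invariant because V is conjugate to a plain shift by
    rho.  Maximality ([graph_maximal]) holds since every vector v differs from
    some u in the graph by an eigenvector of J on which the form has the wrong
    sign; density ([graph_dense]) holds since every finitely supported vector
    splits along the two graphs. *)

(** * Scalars: real or complex numbers *)

Section Scalars.
Variables (R : realType) (k : scalar_kind).
Local Notation K := (scalarField R k).

Definition ofR : R -> K :=
  match k with RealScalars => idfun | ComplexScalars => real_complex R end.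

Definition absR (z : K) : R := re `|z|.

Lemma ofRD : {morph ofR : x y / x + y}.
Proof. by rewrite /ofR; case: k => x y //=; rewrite rmorphD. Qed.

Lemma ofRM : {morph ofR : x y / x * y}.
Proof. by rewrite /ofR; case: k => x y //=; rewrite rmorphM. Qed.

Lemma ofRN : {morph ofR : x / - x}.
Proof. by rewrite /ofR; case: k => x //=; rewrite rmorphN. Qed.

Lemma ofR0 : ofR 0 = 0.
Proof. by rewrite /ofR; case: k. Qed.

Lemma ofR1 : ofR 1 = 1.
Proof. by rewrite /ofR; case: k. Qed.

Lemma ler_ofR x y : (ofR x <= ofR y) = (x <= y).
Proof. by rewrite /ofR; case: k => //=; rewrite lecR. Qed.

Lemma ltr_ofR x y : (ofR x < ofR y) = (x < y).
Proof. by rewrite /ofR; case: k => //=; rewrite ltcR. Qed.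

Lemma re_ofR x : re (ofR x) = x.
Proof. by rewrite /ofR /re; case: k. Qed.

Lemma ofR_re (z : K) : 0 <= z -> ofR (re z) = z.
Proof.
rewrite /ofR /re; case: k z => //= -[a b].
by rewrite lecE/= => /andP[/eqP -> _].
Qed.

Lemma ofR_absR (z : K) : ofR (absR z) = `|z|.
Proof. exact: ofR_re. Qed.

Lemma conj_ofR x : conj (ofR x) = ofR x.
Proof. by rewrite /ofR /conj; case: k => //=; rewrite oppr0. Qed.

Lemma conjD : {morph @conj R k : x y / x + y}.
Proof. by rewrite /conj; case: k => //= x y; rewrite rmorphD. Qed.

Lemma conjM : {morph @conj R k : x y / x * y}.
Proof. by rewrite /conj; case: k => //= x y; rewrite rmorphM. Qed.

Lemma conjN : {morph @conj R k : x / - x}.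
Proof. by rewrite /conj; case: k => //= x; rewrite rmorphN. Qed.

Lemma conj_invol : involutive (@conj R k).
Proof. by rewrite /conj; case: k => //= x; rewrite conjcK. Qed.

Lemma mul_conj (z : K) : z * conj z = ofR (absR z ^+ 2).
Proof.
rewrite expr2 ofRM ofR_absR -expr2 /conj; case: k z => /= [x|].
  by rewrite real_normK ?num_real ?expr2.
case=> a b; rewrite normc_def/= -rmorphXn/= sqr_sqrtr; last first.
  by rewrite addr_ge0 ?sqr_ge0.
by simpc; rewrite -!expr2 [b * a]mulrC addNr.
Qed.

Lemma absR_ge0 z : 0 <= absR z.
Proof. by rewrite -ler_ofR ofR0 ofR_absR. Qed.

Lemma absRM : {morph absR : x y / x * y}.
Proof.
by move=> x y; rewrite -[LHS]re_ofR -[RHS]re_ofR ofRM !ofR_absR normrM.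
Qed.

Lemma absRD x y : absR (x + y) <= absR x + absR y.
Proof. by rewrite -ler_ofR ofRD !ofR_absR ler_normD. Qed.

Lemma absRN x : absR (- x) = absR x.
Proof. by rewrite /absR normrN. Qed.

Lemma absRB x y : absR (x - y) = absR (y - x).
Proof. by rewrite -absRN opprB. Qed.

Lemma absR_ofR x : absR (ofR x) = `|x|.
Proof.
have h y : 0 <= y -> absR (ofR y) = y.
  by move=> y0; rewrite /absR ger0_norm ?re_ofR// -ofR0 ler_ofR.
by case: (ger0P x) => x0; [exact: h|rewrite -absRN -ofRN h// oppr_ge0 ltW].
Qed.

Lemma absR0 : absR 0 = 0.
Proof. by rewrite -ofR0 absR_ofR normr0. Qed.

Lemma absR_eq0 z : (absR z == 0) = (z == 0).
Proof.
apply/eqP/eqP => [h|->]; last exact: absR0.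
by apply/eqP; rewrite -normr_eq0 -ofR_absR h ofR0.
Qed.

Lemma absR_conj z : absR (conj z) = absR z.
Proof.
have e : absR (conj z) ^+ 2 = absR z ^+ 2.
  by rewrite -[LHS]re_ofR -mul_conj conj_invol mulrC mul_conj re_ofR.
by apply/eqP; rewrite -(@eqrXn2 _ 2) ?absR_ge0// e.
Qed.

Lemma absR_lt z x : (absR z < x) = (`|z| < ofR x).
Proof. by rewrite -ofR_absR ltr_ofR. Qed.

(** Radii range over the scalar field itself in the norm topology, but a
    positive scalar is real. *)
Lemma cvg_absRP {T} (F : set_system T) {FF : Filter F} (f : T -> K) (l : K) :
  f @ F --> l <-> forall e : R, 0 < e -> \forall t \near F, absR (l - f t) < e.
Proof.
split=> [/cvgrPdist_lt h e e0|h].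
  have := h (ofR e); rewrite -ofR0 ltr_ofR => /(_ e0).
  by apply: filterS => t; rewrite absR_lt.
apply/cvgrPdist_lt => e e0; have E := ofR_re (ltW e0).
have : 0 < re e by rewrite -ltr_ofR E ofR0.
by move/h; apply: filterS => t; rewrite absR_lt E.
Qed.

Lemma real_complete {T} (F : set_system T) {FF : ProperFilter F} (f : T -> R) :
  (forall e : R, 0 < e -> exists x, \forall t \near F, `|x - f t| < e) ->
  exists l : R, forall e : R, 0 < e -> \forall t \near F, `|l - f t| < e.
Proof.
move=> h; have : cvg (f @ F).
  apply: R_complete; apply: cauchy_exP => e e0.
  by have [x hx] := h e e0; exists x.
by case/cvg_ex => l /cvgrPdist_lt hl; exists l.
Qed.

(** A complex function converges as soon as its real and imaginary parts do. *)
Lemma scalar_complete {T} (F : set_system T) {FF : ProperFilter F} (f : T -> K) :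
  (forall e : R, 0 < e -> exists x, \forall t \near F, absR (x - f t) < e) ->
  exists l : K, f @ F --> l.
Proof.
move=> h; suff [l hl] : exists l : K, forall e : R, 0 < e ->
    \forall t \near F, absR (l - f t) < e by exists l; apply/cvg_absRP.
move: f h; rewrite /absR /re /=; case: k => f h; first exact: real_complete.
have le_re (z : R[i]) : `|complex.Re z| <= complex.Re `|z|.
  by case: z => a b /=; rewrite -sqrtr_sqr ler_wsqrtr// lerDl sqr_ge0.
have le_im (z : R[i]) : `|complex.Im z| <= complex.Re `|z|.
  by case: z => a b /=; rewrite -sqrtr_sqr ler_wsqrtr// lerDr sqr_ge0.
have [|a ha] := @real_complete T F _ (@complex.Re R \o f).
  move=> e /h[x hx]; exists (complex.Re x); apply: filterS hx => t /=.
  by apply: le_lt_trans; rewrite -raddfB le_re.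
have [|b hb] := @real_complete T F _ (@complex.Im R \o f).
  move=> e /h[x hx]; exists (complex.Im x); apply: filterS hx => t /=.
  by apply: le_lt_trans; rewrite -raddfB le_im.
exists (Complex a b) => e e0; have e2 : 0 < e / 2 by rewrite divr_gt0.
apply: filterS2 (ha _ e2) (hb _ e2) => t /=.
case: (f t) => c d /= hc hd; rewrite (splitr e).
apply: le_lt_trans (ltrD hc hd).
have sub x y : Num.sqrt (x ^+ 2 + y ^+ 2) <= `|x| + `|y|.
  rewrite -ler_sqr ?nnegrE ?sqrtr_ge0 ?addr_ge0// sqr_sqrtr ?addr_ge0 ?sqr_ge0//.
  by rewrite sqrrD !real_normK ?num_real// lerD2r lerDl mulrn_wge0// mulr_ge0.
exact: sub.
Qed.
End Scalars.

(** * The zigzag weight *)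

Section Zigzag.
Variables (R : realType) (c : R).
Hypothesis c_ge1 : 1 <= c.

(** The square leaves room for [zigzag] to climb past (n + 1) c^n from any
    starting value; any factor of subexponential growth keeps the n-th roots
    tending to c. *)
Definition envelope (n : nat) : R := c ^+ n * n.+1%:R ^+ 2.

Let c_gt0 : 0 < c. Proof. exact: lt_le_trans c_ge1. Qed.

Lemma envelope_gt0 n : 0 < envelope n.
Proof. by rewrite mulr_gt0 ?exprn_gt0. Qed.

Lemma envelopeD p q : envelope (p + q) <= envelope p * envelope q.
Proof.
rewrite /envelope mulrACA -exprD ler_pM2l ?exprn_gt0// -!natrX -natrM ler_nat.
by rewrite -expnMn leq_sqr; nia.
Qed.

Lemma envelope_incr p q : envelope p <= envelope (p + q).
Proof.
rewrite /envelope ler_pM ?exprn_ge0 ?(ltW c_gt0)//.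
  by rewrite ler_weXn2l// leq_addr.
by rewrite -!natrX ler_nat leq_sqr ltnS leq_addr.
Qed.

Definition orient (s : bool) (x : R) : R := if s then x else x^-1.

(** The boolean is the direction of the last step, [true] for up: read through
    [orient], every run is a climb, and it is reversed when the threshold
    n.+1%:R * c ^+ n has been reached. *)
Fixpoint zigzag (n : nat) : R * bool :=
  if n is m.+1 then
    let: (g, s) := zigzag m in
    let s' := (m.+1%:R * c ^+ m <= orient s g) (+) s in
    (g * orient s' (envelope m.+1 / envelope m), s')
  else (1, true).

Let g n := (zigzag n).1.
Let s n := (zigzag n).2.
Let r n := envelope n.+1 / envelope n.

Let sS n : s n.+1 = (n.+1%:R * c ^+ n <= orient (s n) (g n)) (+) s n.
Proof. by rewrite /s /g /=; case: (zigzag n). Qed.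

Let gS n : g n.+1 = g n * orient (s n.+1) (r n).
Proof. by rewrite /s /g /=; case: (zigzag n). Qed.

Let r_ge1 n : 1 <= r n.
Proof. by rewrite ler_pdivlMr ?envelope_gt0// mul1r -addn1 envelope_incr. Qed.

Let r_gt0 n : 0 < r n. Proof. exact: lt_le_trans (r_ge1 n). Qed.

Lemma orient_gt0 b x : 0 < x -> 0 < orient b x.
Proof. by case: b => //= x0; rewrite invr_gt0. Qed.

Lemma orientM b x y : orient b (x * y) = orient b x * orient b y.
Proof. by case: b => //=; rewrite invfM. Qed.

Lemma orientK b x : orient b (orient b x) = x.
Proof. by case: b => //=; rewrite invrK. Qed.

Let g_gt0 n : 0 < g n.
Proof. by elim: n => [|n IH]; rewrite ?gS ?mulr_gt0 ?orient_gt0// /g. Qed.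

Let g_orient b p q : orient b (g (p + q)) <= orient b (g p) * (envelope (p + q) / envelope p).
Proof.
elim: q => [|q IH]; first by rewrite addn0 divff ?mulr1// gt_eqF// envelope_gt0.
rewrite addnS gS orientM.
have -> : envelope (p + q).+1 / envelope p = envelope (p + q) / envelope p * r (p + q).
  by rewrite /r; field; rewrite !gt_eqF// envelope_gt0.
rewrite mulrA ler_pM// ?(ltW (orient_gt0 _ _))// ?orient_gt0//.
have rV : (r (p + q))^-1 <= r (p + q).
  by apply: le_trans (r_ge1 _); rewrite invf_le1.
by case: b {IH}; case: (s _) => //=; rewrite invrK.
Qed.

(** Without a reversal after n, the oriented value at n + j is a constant
   multiple of c ^+ (n + j) * (n + j).+1%:R ^+ 2, which exceeds the threshold
   for large j. *)
Let hits n : exists m, [/\ (n <= m)%N, s m = s n & m.+1%:R * c ^+ m <= orient (s n) (g m)].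
Proof.
apply: contrapT => no.
have run j : s (n + j) = s n /\
    orient (s n) (g (n + j)) = orient (s n) (g n) * (envelope (n + j) / envelope n).
  elim: j => [|j [IHs IHg]].
    by rewrite addn0 divff ?mulr1// gt_eqF// envelope_gt0.
  have e : s (n + j.+1) = s n.
    rewrite addnS sS IHs; case: leP => //= h.
    by case: no; exists (n + j)%N; rewrite leq_addr.
  split=> //; rewrite addnS gS -addnS e orientM orientK IHg addnS /r.
  by field; rewrite !gt_eqF// envelope_gt0.
pose K := envelope n / orient (s n) (g n).
have K0 : 0 < K by rewrite divr_gt0 ?envelope_gt0 ?orient_gt0.
have [j hj] : exists j : nat, K <= (n + j).+1%:R.
  exists (Num.bound K); apply: ltW; apply: lt_le_trans (archi_boundP (ltW K0)) _.
  by rewrite ler_nat leqW// leq_addl.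
have [ej egj] := run j; case: no; exists (n + j)%N; split=> //; first exact: leq_addr.
rewrite egj /envelope -/(envelope n).
rewrite ler_pdivrMr ?orient_gt0// in hj.
rewrite mulrA ler_pdivlMr ?envelope_gt0//.
have := ler_wpM2l (mulr_ge0 (ler0n R (n + j).+1) (exprn_ge0 (n + j) (ltW c_gt0))) hj.
by rewrite expr2; congr (_ <= _); ring.
Qed.

(** One run may have the wrong direction; the next one has the right one. *)
Let hits_both b n0 : exists m, (n0 <= m)%N /\ m.+1%:R * c ^+ m <= orient b (g m).
Proof.
have [m [nm sm hm]] := hits n0.
have [e|ne] := eqVneq (s n0) b; first by exists m; rewrite -e.
have sb : s m.+1 = b.
  by rewrite sS sm hm /=; case: (s n0) b ne => -[].
have [l [ml _ hl]] := hits m.+1; exists l; rewrite sb in hl; split=> //.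
exact: leq_trans nm (leq_trans (leqnSn m) ml).
Qed.

Lemma zigzag_weight : exists g : nat -> R, [/\ forall n, 0 < g n,
    forall p q, g (p + q)%N <= envelope q * g p /\ g p <= envelope q * g (p + q)%N &
    forall (b : bool) (M : R) n0, exists n, (n0 <= n)%N /\ M * c ^+ n < orient b (g n)].
Proof.
exists g; split=> [//|p q|b M n0].
  have le : envelope (p + q) / envelope p <= envelope q.
    by rewrite ler_pdivrMr ?envelope_gt0// mulrC envelopeD.
  split.
    rewrite mulrC; apply: le_trans (g_orient true p q) _.
    by rewrite /= ler_pM2l.
  have := g_orient false p q; rewrite /= => h.
  have {h} : (g (p + q))^-1 <= (g p)^-1 * envelope q.
    by apply: le_trans h _; rewrite ler_pM2l ?invr_gt0.
  by rewrite mulrC ler_pdivlMr// mulrC ler_pdivrMr.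
have [m [nm hm]] := hits_both b (maxn n0 (Num.bound `|M|)).
exists m; split; first exact: leq_trans (leq_maxl _ _) nm.
apply: lt_le_trans hm; rewrite ltr_pM2r ?exprn_gt0//.
apply: le_lt_trans (ler_norm M) _.
apply: lt_le_trans (archi_boundP (normr_ge0 M)) _.
by rewrite ler_nat; apply: leq_trans (leq_maxr _ _) (leq_trans nm _).
Qed.
End Zigzag.

(** * Spectral radii, adjoints and inverses in a Hilbert space *)

Section HilbertOperators.
Variables (R : realType) (k : scalar_kind) (H : hilbertSpace R k).
Local Notation K := (scalarField R k).
Implicit Types (x y z : H) (L : set H) (T : H -> H).

Lemma adjoint_eq T T' :
  (forall x y, inner H (T x) y = inner H x (T' y)) -> adjoint T = T'.
Proof.
move=> TT'; apply/funext => y; rewrite /adjoint.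
case: xgetP => [z _ /= hz|/(_ (T' y))]; last by case=> x; exact: TT'.
apply/eqP; rewrite -subr_eq0 -normr_eq0 -sqrf_eq0 -inner_norm linearBr/=.
by rewrite -hz TT' subrr.
Qed.

Lemma inverse_eq T T' : cancel T T' -> cancel T' T -> inverse T = T'.
Proof.
move=> c1 c2; apply/funext => y; rewrite /inverse.
case: xgetP => [z _ /= <-|/(_ (T' y))]; first by rewrite c1.
by case; exact: c2.
Qed.

Lemma nrm_ge0 x : 0 <= nrm x.
Proof. by rewrite -(ler_ofR k) ofR0 ofR_re. Qed.

Lemma nrmZ (a : K) x : nrm (a *: x) = absR a * nrm x.
Proof. by rewrite /nrm normrZ -ofR_absR -{1}(ofR_re (normr_ge0 x)) -ofRM re_ofR. Qed.

Lemma nrm_eq0 x : nrm x = 0 -> x = 0.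
Proof.
by move=> h; apply/eqP; rewrite -normr_eq0 -(ofR_re (normr_ge0 x)) -/(nrm x) h ofR0.
Qed.

Lemma nrm0 : nrm (0 : H) = 0.
Proof. by rewrite /nrm normr0 -(ofR0 R k) re_ofR. Qed.

(** ln (n + 1) is at most a multiple of the square root of n + 1, which is
   negligible against n. *)
Lemma nthroot_poly_cvg :
  (fun N : nat => (N.+1%:R ^+ 2 : R) `^ N%:R^-1) @ \oo --> (1 : R).
Proof.
have lim0 : (fun N : nat => N%:R^-1 * ln (N.+1%:R ^+ 2 : R)) @ \oo --> (0 : R).
  apply/cvgrPdist_lt => e e0; near=> N.
  have N0 : (0 : R) < N%:R by rewrite ltr0n; near: N; exists 1%N.
  have big : 64 / e ^+ 2 < N%:R by near: N; exact: nbhs_infty_gtr.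
  pose s : R := Num.sqrt N.+1%:R.
  have s0 : 0 < s by rewrite sqrtr_gt0.
  have s2 : s ^+ 2 = N%:R + 1 by rewrite sqr_sqrtr// natr1.
  have l0 : 0 <= ln (N.+1%:R ^+ 2 : R) by rewrite ln_ge0// exprn_ege1// ler1n.
  have lE : ln (N.+1%:R ^+ 2 : R) <= 4 * s.
    rewrite -natr1 -s2 -exprM lnXn// -[_ *+ _]mulr_natl.
    by rewrite ler_pM2l// ltW// ln_sublinear.
  rewrite sub0r normrN ger0_norm ?mulr_ge0 ?invr_ge0// mulrC ltr_pdivrMr//.
  apply: le_lt_trans lE _.
  rewrite -ltr_sqr ?nnegrE ?mulr_ge0 ?(ltW s0) ?(ltW N0) ?(ltW e0)//.
  rewrite !exprMn s2; move: big; rewrite ltr_pdivrMr ?exprn_gt0//.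
  have N1 : (1 : R) <= N%:R by rewrite ler1n -(ltr0n R).
  by move: (e ^+ 2) (exprn_gt0 2 e0) (N%:R : R) N1 N0 => d d0 n n1 n0; nra.
have -> : (fun N : nat => (N.+1%:R ^+ 2 : R) `^ N%:R^-1) =
    expR \o (fun N : nat => N%:R^-1 * ln (N.+1%:R ^+ 2 : R)).
  by apply/funext => N; rewrite /powR sqrf_eq0 pnatr_eq0.
rewrite -[X in _ --> X]expR0; apply: continuous_cvg; [exact: continuous_expR|exact: lim0].
Unshelve. all: by end_near. Qed.

(** The norms a N of the restricted powers are submultiplicative.  If
    a m < c ^+ m for some m > 0, then a N / c ^+ N is bounded by Euclidean
    division of N by m, and L is contained in [Sset T c].  So
    c ^+ N <= a N <= envelope c N. *)
Lemma specradius_onE (c : R) T L : 1 <= c -> linear T ->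
  (forall N x, nrm (iter N T x) <= envelope c N * nrm x) ->
  Sset T c = [set 0] ->
  closed_submod L -> L <> [set 0] -> invariant_under T L ->
  specradius_on L T = c.
Proof.
move=> c1 Tlin Tbd TS [Lsub _] Lne TL.
have c0 : 0 < c by exact: lt_le_trans c1.
have TNlin N : linear (iter N T).
  by move=> a x y; elim: N => //= N ->; exact: Tlin.
have TN0 N : iter N T 0 = 0.
  by have := TNlin N (-1) 0 0; rewrite !scaleN1r !addNr.
have L0 : L 0 by have := Lsub.1; rewrite inE.
have LZ a x : L x -> L (a *: x).
  by move=> Lx; have := Lsub.2 a x 0; rewrite addr0 !inE; apply.
have LTN N x : L x -> L (iter N T x).
  by move=> Lx; elim: N => //= N IH; apply: TL; exists (iter N T x).
have [x0 [Lx0 x00]] : exists x, L x /\ x != 0.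
  apply: contrapT => h; apply: Lne; apply/seteqP; split=> [x Lx|_ ->//] /=.
  by apply: contrapT => /eqP xn0; apply: h; exists x.
pose E := envelope c.
have E0 N : 0 <= E N by rewrite ltW// envelope_gt0.
pose a N := opnorm_on L (iter N T).
pose S N := [set nrm (iter N T x) | x in L `&` [set x | nrm x <= 1]].
have Sne N : S N !=set0.
  by exists (nrm (iter N T 0)); exists 0 => //; split => //=; rewrite nrm0.
have Sub N : ubound (S N) (E N).
  move=> _ [x [_ /= x1] <-]; apply: le_trans (Tbd N x) _.
  by rewrite -[leRHS]mulr1 ler_wpM2l ?E0.
have aE N : a N <= E N by exact: ge_sup (Sne N) (Sub N).
have aT N x : L x -> nrm (iter N T x) <= a N * nrm x.
  move=> Lx; have [->|xn0] := eqVneq x 0; first by rewrite TN0 nrm0 mulr0.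
  have nx : 0 < nrm x.
    by rewrite lt_def nrm_ge0 andbT; apply: contraNneq xn0 => /nrm_eq0 ->.
  rewrite -ler_pdivrMr//.
  have -> : nrm (iter N T x) / nrm x = nrm (iter N T (ofR k (nrm x)^-1 *: x)).
    have := TNlin N (ofR k (nrm x)^-1) x 0; rewrite !addr0 TN0 addr0 => ->.
    by rewrite nrmZ absR_ofR ger0_norm ?invr_ge0 ?ltW// mulrC.
  apply: ub_le_sup; first by exists (E N); exact: Sub.
  exists (ofR k (nrm x)^-1 *: x) => //; split; first exact: LZ.
  by rewrite /= nrmZ absR_ofR ger0_norm ?invr_ge0 ?(ltW nx)// mulVf// gt_eqF.
have a0 N : 0 <= a N.
  have nx : 0 < nrm x0.
    by rewrite lt_def nrm_ge0 andbT; apply: contraNneq x00 => /nrm_eq0 ->.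
  by rewrite -(pmulr_lge0 _ nx); exact: le_trans (nrm_ge0 _) (aT N _ Lx0).
have aM m n : a (m + n) <= a m * a n.
  apply: ge_sup (Sne _) _ => _ [x [Lx /= x1] <-]; rewrite iterD.
  apply: le_trans (aT m _ (LTN _ _ Lx)) _; rewrite ler_wpM2l ?a0//.
  by apply: le_trans (aT n _ Lx) _; rewrite -[leRHS]mulr1 ler_wpM2l ?a0.
have ca m : (0 < m)%N -> c ^+ m <= a m.
  move=> m0; rewrite leNgt; apply/negP => am.
  have aq q r : a (q * m + r)%N <= c ^+ (q * m) * a r.
    elim: q => [|q IH]; first by rewrite mul0n expr0 mul1r.
    rewrite mulSn -addnA; apply: le_trans (aM _ _) _.
    by rewrite exprD -mulrA ler_pM// ltW.
  have : Sset T c x0.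
    exists (E m * nrm x0) => [|N]; first by rewrite mulr_ge0// nrm_ge0.
    apply: le_trans (aT N _ Lx0) _; rewrite mulrAC ler_wpM2r ?nrm_ge0//.
    rewrite {1}(divn_eq N m); apply: le_trans (aq _ _) _.
    rewrite mulrC ler_pM ?exprn_ge0 ?(ltW c0)//.
      have mono p q : (p <= q)%N -> E p <= E q by move=> /subnKC <-; exact: envelope_incr.
      by apply: le_trans (aE _) (mono _ _ _); rewrite ltnW// ltn_pmod.
    by apply: ler_weXn2l => //; exact: leq_trunc_div.
  by rewrite TS /= => /eqP; rewrite (negbTE x00).
rewrite /specradius_on; apply: cvg_lim => //.
apply: (@squeeze_cvgr _ _ _ _ (fun=> c) (fun N : nat => c * ((N.+1%:R ^+ 2) `^ N%:R^-1))).
- exists 1%N => // N /= N0.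
  have rt : (c ^+ N) `^ N%:R^-1 = c.
    rewrite -powR_mulrn ?(ltW c0)// -powRrM divff ?powRr1 ?(ltW c0)//.
    by rewrite pnatr_eq0 -lt0n.
  apply/andP; split.
    rewrite -{1}rt; apply: ge0_ler_powR; rewrite ?invr_ge0 ?nnegrE ?exprn_ge0 ?(ltW c0)//.
      exact: a0.
    exact: ca.
  rewrite -[X in _ <= X * _]rt -powRM ?exprn_ge0 ?(ltW c0)//.
  by apply: ge0_ler_powR; rewrite ?invr_ge0 ?nnegrE ?E0//; [exact: a0|exact: aE].
- exact: cvg_cst.
- by rewrite -[X in _ --> X]mulr1; apply: cvgMr; exact: nthroot_poly_cvg.
Qed.
End HilbertOperators.

(** * Unconditional sums of scalars *)

Section Sums.
Variables (R : realType) (k : scalar_kind) (I : choiceType).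
Local Notation K := (scalarField R k).
Implicit Types (A B : {fset I}) (f g : I -> K).
Local Existing Instance totally_filter.

Definition sums_to f (s : K) :=
  (fun A : {fset I} => \sum_(i <- A) f i) @ totally --> s.

Lemma sums_to_unique f s t : sums_to f s -> sums_to f t -> s = t.
Proof. exact: cvg_unique. Qed.

Lemma eq_sums_to f g s : f =1 g -> sums_to f s -> sums_to g s.
Proof. by move=> /funext ->. Qed.

Lemma sums_toD f g s t :
  sums_to f s -> sums_to g t -> sums_to (fun i => f i + g i) (s + t).
Proof.
move=> hf hg; rewrite /sums_to (_ : (fun _ => _) =
  (fun A => \sum_(i <- A) f i + \sum_(i <- A) g i)); first exact: cvgD.
by apply/funext => A; rewrite big_split.
Qed.

Lemma sums_toZ a f s : sums_to f s -> sums_to (fun i => a * f i) (a * s).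
Proof.
move=> hf; rewrite /sums_to (_ : (fun _ => _) =
  (fun A => a * \sum_(i <- A) f i)); first by apply: cvgMr.
by apply/funext => A; rewrite mulr_sumr.
Qed.

Lemma sums_toN f s : sums_to f s -> sums_to (fun i => - f i) (- s).
Proof.
move=> /(sums_toZ (a := -1)); rewrite mulN1r; apply: eq_sums_to => i.
by rewrite mulN1r.
Qed.

Lemma sums_to_conj f s : sums_to f s -> sums_to (fun i => conj (f i)) (conj s).
Proof.
move=> /cvg_absRP h; apply/cvg_absRP => e /h; apply: filterS => A.
rewrite (_ : \sum_(i <- A) conj (f i) = conj (\sum_(i <- A) f i)); last first.
  by rewrite (big_morph _ (@conjD R k) (_ : conj 0 = 0))// -(@ofR0 R k) conj_ofR.
by rewrite -conjN -conjD absR_conj.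
Qed.

Lemma sums_to_reindex (phi psi : I -> I) f s :
  cancel phi psi -> cancel psi phi -> sums_to f s -> sums_to (f \o phi) s.
Proof.
move=> c1 c2 hf X /hf [A _ hA].
exists [fset psi i | i in A]%fset => // B /= sub.
have -> : \sum_(i <- B) f (phi i) = \sum_(i <- [fset phi i | i in B]%fset) f i.
  by rewrite big_imfset//=; move=> i j _ _; exact: can_inj c1 _ _.
apply: hA => /=; apply/fsubsetP => i iA; rewrite -(c2 i).
by apply: in_imfset => /=; apply: (fsubsetP sub); exact: in_imfset.
Qed.

(** The sum of a nonnegative family is the supremum of its finite sums; stated
    through approximations because this is how convergence uses it. *)
Lemma bounded_sum_sup (g : I -> R) (M : R) :
  (forall i, 0 <= g i) -> (forall A, \sum_(i <- A) g i <= M) ->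
  exists s : R, (forall A, \sum_(i <- A) g i <= s) /\
    forall e, 0 < e -> exists A, s - e < \sum_(i <- A) g i.
Proof.
move=> g0 gM; pose S := [set \sum_(i <- A) g i | A in @setT {fset I}].
have Sne : S !=set0 by exists (\sum_(i <- (fset0 : {fset I})) g i); exists fset0.
have Sub : ubound S M by move=> _ [A _ <-].
exists (sup S); split=> [A|e e0].
- by apply: ub_le_sup; [exists M|exists A].
- have [_ [A _ <-]] := sup_adherent e0 (Logic.conj Sne (ex_intro _ M Sub)).
  by exists A.
Qed.

Lemma sum_fset_sub (V : zmodType) (g : I -> V) A B : (A `<=` B)%fset ->
  \sum_(i <- B) g i - \sum_(i <- A) g i = \sum_(i <- (B `\` A)%fset) g i.
Proof.
move=> AB; apply/eqP; rewrite subr_eq addrC -big_cat/=; apply/eqP.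
apply: perm_big; apply: uniq_perm; rewrite ?fset_uniq//.
  rewrite cat_uniq !fset_uniq/= andbT; apply/hasPn => i /=.
  by rewrite in_fsetD => /andP[].
move=> i; rewrite mem_cat in_fsetD; case: (boolP (i \in A)) => //= iA.
by rewrite (fsubsetP AB).
Qed.

Lemma absR_sum (s : seq I) f : absR (\sum_(i <- s) f i) <= \sum_(i <- s) absR (f i).
Proof.
elim/big_ind2: _ => [|x y x' y' h h'|//]; first by rewrite absR0.
exact: le_trans (absRD _ _) (lerD h h').
Qed.

(** Beyond a finite set that carries almost all of the absolute values, the
   partial sums vary little. *)
Lemma sums_to_ex f (M : R) : (forall A, \sum_(i <- A) absR (f i) <= M) ->
  exists s, sums_to f s.
Proof.
move=> /(bounded_sum_sup (fun i => absR_ge0 (f i)))[S [hS S_sup]].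
apply: scalar_complete => e /S_sup[A0 hA0].
exists (\sum_(i <- A0) f i); exists A0 => // B /= AB.
rewrite absRB sum_fset_sub//; apply: le_lt_trans (absR_sum _ _) _.
by rewrite -sum_fset_sub//; move: (hS B) hA0; lra.
Qed.

Lemma sums_to_ge0 (g : I -> R) (M : R) : (forall i, 0 <= g i) ->
  (forall A, \sum_(i <- A) g i <= M) ->
  exists s : R, [/\ sums_to (ofR k \o g) (ofR k s),
    forall A, \sum_(i <- A) g i <= s &
    forall e, 0 < e -> exists A, s - e < \sum_(i <- A) g i].
Proof.
move=> g0 /(bounded_sum_sup g0)[s [hs s_sup]].
exists s; split=> //; apply/cvg_absRP => e /[dup] e0 /s_sup[A hA].
exists A => // B /= AB.
rewrite -(big_morph _ (@ofRD R k) (@ofR0 R k)) -ofRN -ofRD absR_ofR.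
have hB : \sum_(i <- A) g i <= \sum_(i <- B) g i.
  by rewrite -subr_ge0 sum_fset_sub// sumr_ge0.
by rewrite ger0_norm ?subr_ge0//; move: hA hB; lra.
Qed.
End Sums.

(** * The Hilbert space l2(I) *)

Section L2.
Variables (R : realType) (k : scalar_kind) (I : choiceType).
Local Notation K := (scalarField R k).
Local Existing Instance totally_filter.

Definition sq_summable : {pred I -> K^o} := fun x =>
  `[< exists M : R, forall A : {fset I}, \sum_(i <- A) absR (x i) ^+ 2 <= M >].

Lemma sq_summableP (x : I -> K^o) :
  reflect (exists M : R, forall A : {fset I}, \sum_(i <- A) absR (x i) ^+ 2 <= M)
          (x \in sq_summable).
Proof. exact: asboolP. Qed.

Lemma sq_summable_submod : submod_closed sq_summable.
Proof.
split=> [|a x y xP yP].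
  by apply/sq_summableP; exists 0 => A; rewrite big1// => i _; rewrite absR0 expr0n.
have [M hM] := sq_summableP _ xP; have [N hN] := sq_summableP _ yP.
apply/sq_summableP; exists (2 * (absR a ^+ 2 * M + N)) => A.
apply: (@le_trans _ _ (2 * (absR a ^+ 2 * (\sum_(i <- A) absR (x i) ^+ 2) +
                         \sum_(i <- A) absR (y i) ^+ 2))); last first.
  by rewrite ler_pM2l// lerD// ler_wpM2l ?sqr_ge0.
rewrite mulr_sumr -big_split/= mulr_sumr ler_sum// => i _.
rewrite -exprMn -absRM.
have h : absR (a * x i + y i) ^+ 2 <= (absR (a * x i) + absR (y i)) ^+ 2.
  by rewrite ler_sqr ?nnegrE ?addr_ge0 ?absR_ge0// absRD.
apply: le_trans h _.
by have := sqr_ge0 (absR (a * x i) - absR (y i)); nra.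
Qed.

HB.instance Definition _ := GRing.isSubmodClosed.Build _ _ sq_summable
  sq_summable_submod.

Record l2 := L2 { l2_val :> I -> K^o ; l2_valP : l2_val \in sq_summable }.

HB.instance Definition _ := [isSub for l2_val].
HB.instance Definition _ := [Choice of l2 by <:].
HB.instance Definition _ := [SubChoice_isSubLmodule of l2 by <:].

Implicit Types (x y z : l2) (A B : {fset I}).

Lemma l2P x y : (forall i, x i = y i) -> x = y.
Proof. by move=> h; apply/val_inj/funext. Qed.

Lemma l2D x y i : (x + y) i = x i + y i. Proof. by []. Qed.
Lemma l2N x i : (- x) i = - x i. Proof. by []. Qed.
Lemma l2Z (a : K) x i : (a *: x) i = a * x i. Proof. by []. Qed.
Lemma l20 i : (0 : l2) i = 0. Proof. by []. Qed.

End L2.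

Section L2norm.
Variables (R : realType) (k : scalar_kind) (I : choiceType).
Local Notation K := (scalarField R k).
Local Notation l2 := (l2 R k I).
Local Existing Instance totally_filter.
Implicit Types (x y z : l2) (A B : {fset I}).

Lemma energy_subproof x : exists s : R,
  [/\ sums_to (fun i => ofR k (absR (x i) ^+ 2)) (ofR k s),
      forall A, \sum_(i <- A) absR (x i) ^+ 2 <= s &
      forall e, 0 < e -> exists A, s - e < \sum_(i <- A) absR (x i) ^+ 2].
Proof.
have [M hM] := sq_summableP _ (l2_valP x).
have [s [h1 h2 h3]] := sums_to_ge0 k (fun i => sqr_ge0 (absR (x i))) hM.
by exists s.
Qed.

Definition energy x : R := projT1 (cid (energy_subproof x)).

Lemma energyP x : sums_to (fun i => ofR k (absR (x i) ^+ 2)) (ofR k (energy x)).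
Proof. by rewrite /energy; case: cid => s []. Qed.

Lemma sum_le_energy x A : \sum_(i <- A) absR (x i) ^+ 2 <= energy x.
Proof. by rewrite /energy; case: cid => s []. Qed.

Lemma energy_approx x e : 0 < e ->
  exists A, energy x - e < \sum_(i <- A) absR (x i) ^+ 2.
Proof. by rewrite /energy; case: cid => s [] /= _ _; apply. Qed.

Lemma energy_ge0 x : 0 <= energy x.
Proof.
have := sum_le_energy x fset0.
by rewrite big_seq_fset0.
Qed.

Lemma energy_le x M : (forall A, \sum_(i <- A) absR (x i) ^+ 2 <= M) -> energy x <= M.
Proof.
move=> h; apply/ler_addgt0Pr => e /(energy_approx x)[A hA].
by move: (h A) hA; lra.
Qed.

Definition l2norm x : R := Num.sqrt (energy x).

Lemma l2norm_ge0 x : 0 <= l2norm x. Proof. exact: sqrtr_ge0. Qed.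

Lemma sqr_l2norm x : l2norm x ^+ 2 = energy x.
Proof. by rewrite sqr_sqrtr// energy_ge0. Qed.

Lemma l2norm_le x C : 0 <= C ->
  (forall A, \sum_(i <- A) absR (x i) ^+ 2 <= C ^+ 2) -> l2norm x <= C.
Proof.
by move=> C0 /energy_le h; rewrite -ler_sqr ?nnegrE ?l2norm_ge0// sqr_l2norm.
Qed.

Lemma absR_le_l2norm x i : absR (x i) <= l2norm x.
Proof.
rewrite -ler_sqr ?nnegrE ?absR_ge0 ?l2norm_ge0// sqr_l2norm.
by have := sum_le_energy x [fset i]%fset; rewrite big_seq_fset1.
Qed.

Lemma l2norm_eq0 x : l2norm x = 0 -> x = 0.
Proof.
move=> h; apply: l2P => i; apply/eqP; rewrite -absR_eq0.
by rewrite eq_le absR_ge0 andbT -h absR_le_l2norm.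
Qed.

(** Minkowski's inequality without that of Cauchy and Schwarz: sum up
    (a + b)^2 <= (1 + t) a^2 + (1 + 1 / t) b^2 for the optimal t, which is the
    quotient of the norms of y and x. *)
Lemma l2normD x y : l2norm (x + y) <= l2norm x + l2norm y.
Proof.
have [/eqP/l2norm_eq0 ->|x0] := boolP (l2norm x == 0).
  by rewrite add0r lerDr l2norm_ge0.
have [/eqP/l2norm_eq0 ->|y0] := boolP (l2norm y == 0).
  by rewrite addr0 lerDl l2norm_ge0.
have {x0}Fp : 0 < l2norm x by rewrite lt_def x0 l2norm_ge0.
have {y0}Gp : 0 < l2norm y by rewrite lt_def y0 l2norm_ge0.
apply: l2norm_le => [|A]; first by rewrite addr_ge0 ?l2norm_ge0.
move: (sum_le_energy x A) (sum_le_energy y A); rewrite -!sqr_l2norm.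
move: (l2norm x) (l2norm y) Fp Gp => F G F0 G0 hx hy.
apply: (@le_trans _ _ ((1 + G / F) * (\sum_(i <- A) absR (x i) ^+ 2) +
                       (1 + F / G) * (\sum_(i <- A) absR (y i) ^+ 2))).
  rewrite !mulr_sumr -big_split/= ler_sum// => i _.
  apply: (@le_trans _ _ ((absR (x i) + absR (y i)) ^+ 2)).
    by rewrite ler_sqr ?nnegrE ?addr_ge0 ?absR_ge0// absRD.
  move: (absR (x i)) (absR (y i)) => a b; rewrite -subr_ge0.
  have -> : (1 + G / F) * a ^+ 2 + (1 + F / G) * b ^+ 2 - (a + b) ^+ 2 =
            (G * a - F * b) ^+ 2 / (F * G) by field; rewrite !gt_eqF.
  by rewrite divr_ge0 ?sqr_ge0 ?mulr_ge0 ?ltW.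
have -> : (F + G) ^+ 2 = (1 + G / F) * F ^+ 2 + (1 + F / G) * G ^+ 2.
  by field; rewrite !gt_eqF.
by rewrite lerD// ler_wpM2l// addr_ge0// divr_ge0 ?ltW.
Qed.

Lemma l2normZ_le (a : K) x : l2norm (a *: x) <= absR a * l2norm x.
Proof.
apply: l2norm_le => [|A]; first by rewrite mulr_ge0 ?absR_ge0 ?l2norm_ge0.
rewrite exprMn sqr_l2norm; apply: le_trans (ler_wpM2l (sqr_ge0 _) (sum_le_energy x A)).
by rewrite mulr_sumr ler_sum// => i _; rewrite l2Z absRM exprMn.
Qed.

Lemma l2normZ (a : K) x : l2norm (a *: x) = absR a * l2norm x.
Proof.
apply/eqP; rewrite eq_le l2normZ_le/=.
have [->|a0] := eqVneq a 0; first by rewrite absR0 mul0r l2norm_ge0.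
have a0' : 0 < absR a by rewrite lt_def absR_eq0 a0 absR_ge0.
have := l2normZ_le a^-1 (a *: x); rewrite scalerA mulVf// scale1r => h.
apply: le_trans (ler_wpM2l (ltW a0') h) _.
by rewrite mulrA -absRM divff// /absR normr1 -(@ofR1 R k) re_ofR mul1r.
Qed.

Let normD x y : ofR k (l2norm (x + y)) <= ofR k (l2norm x) + ofR k (l2norm y).
Proof. by rewrite -ofRD ler_ofR l2normD. Qed.

Let normZ (a : K) x : ofR k (l2norm (a *: x)) = `|a| * ofR k (l2norm x).
Proof. by rewrite l2normZ ofRM ofR_absR. Qed.

Let norm0 x : ofR k (l2norm x) = 0 -> x = 0.
Proof. by move=> h; apply: l2norm_eq0; rewrite -[LHS](@re_ofR R k) h -(@ofR0 R k) re_ofR. Qed.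

HB.instance Definition _ := @Lmodule_isNormed.Build K l2 _ normD normZ norm0.

Lemma norm_l2E x : `|x| = ofR k (l2norm x).
Proof. by []. Qed.

Lemma re_norm_l2 x : re `|x| = l2norm x.
Proof. exact: re_ofR. Qed.

(** The limit is taken coordinatewise; a bound on finite sums of squares of
    differences within the filter passes to it, up to the factor 2. *)
Lemma l2_complete (F : set_system l2) : ProperFilter F -> cauchy F -> cvg F.
Proof.
move=> FF /cauchyP Fc.
have {}Fc e : 0 < e -> exists x, \forall y \near F, l2norm (x - y) < e.
  rewrite -(ltr_ofR k) ofR0 => /Fc[x hx]; exists x; apply: filterS hx => y.
  by rewrite -ball_normE/= norm_l2E ltr_ofR.
have coord i : exists l : K, (fun x : l2 => x i : K) @ F --> l.
  apply: scalar_complete => e /Fc[x hx]; exists (x i); apply: filterS hx => y.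
  by apply: le_lt_trans; exact: (absR_le_l2norm (x - y)).
pose y i : K := projT1 (cid (coord i)).
have hy i e : 0 < e -> \forall x \near F, absR (y i - l2_val x i) < e.
  by move: e; apply/cvg_absRP; rewrite /y; case: cid.
have key x e : 0 < e -> (\forall z \near F, l2norm (x - z) < e) ->
    forall A, \sum_(i <- A) absR (y i - x i) ^+ 2 <= (2 * e) ^+ 2.
  move=> e0 hx A.
  have d0 : 0 < e / (size A).+1%:R by rewrite divr_gt0.
  have hA : \forall z \near F, forall i, i \in A ->
      absR (y i - l2_val z i) < e / (size A).+1%:R.
    move: (e / _) d0 => d d0; suff hs (s : seq I) : \forall z \near F,
        forall i, i \in s -> absR (y i - l2_val z i) < d by exact: hs.
    elim: s => [|j s IH]; first by apply: filterE => z i; rewrite in_nil.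
    apply: filterS2 (hy j _ d0) IH => z hj IH i.
    by rewrite inE => /orP[/eqP ->//|]; exact: IH.
  have [z [xz yz]] := filter_ex (filterI hx hA).
  apply: (@le_trans _ _ (\sum_(i <- A) (2 * absR (y i - z i) ^+ 2) +
                         \sum_(i <- A) (2 * absR ((x - z) i) ^+ 2))).
    rewrite -big_split/= ler_sum// => i _.
    have /(le_trans _) : (absR (y i - z i) + absR ((x - z) i)) ^+ 2 <=
        2 * absR (y i - z i) ^+ 2 + 2 * absR ((x - z) i) ^+ 2.
      by have := sqr_ge0 (absR (y i - z i) - absR ((x - z) i)); nra.
    apply; rewrite ler_sqr ?nnegrE ?addr_ge0 ?absR_ge0//.
    rewrite -(subrKA (z i)); apply: le_trans (absRD _ _) _.
    by rewrite lerD2l absRB.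
  have -> : (2 * e) ^+ 2 = 2 * e ^+ 2 + 2 * e ^+ 2 by ring.
  apply: lerD; rewrite -mulr_sumr ler_pM2l//; last first.
    apply: le_trans (sum_le_energy _ _) _; rewrite -sqr_l2norm.
    by rewrite ler_sqr ?nnegrE ?l2norm_ge0 ?(ltW e0)// ltW.
  apply: (@le_trans _ _ (\sum_(i <- A) (e / (size A).+1%:R) ^+ 2)).
    rewrite big_seq [leRHS]big_seq ler_sum// => i iA.
    by rewrite ler_sqr ?nnegrE ?absR_ge0 ?(ltW d0)// ltW// yz.
  rewrite big_const_seq count_predT iter_addr_0 -[_ *+ size A]mulr_natr expr_div_n -mulrA.
  rewrite ger_pMr ?exprn_gt0// mulrC ler_pdivrMr ?exprn_gt0// mul1r.
  by rewrite -natrX ler_nat; nia.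
have yP : (y : I -> K^o) \in @sq_summable R k I.
  have [x /(key _ _ ltr01) h] := Fc 1 ltr01.
  rewrite -(subrK (x : I -> K^o) y) rpredD ?l2_valP//.
  by apply/sq_summableP; exists ((2 * 1) ^+ 2).
suff hcvg (e : R) : 0 < e -> \forall z \near F, l2norm (L2 yP - z) < e.
  apply/cvg_ex; exists (L2 yP); apply/cvgrPdist_lt => e e0.
  have E := ofR_re (ltW e0).
  have /hcvg : 0 < re e by rewrite -(ltr_ofR k) E ofR0.
  by apply: filterS => z; rewrite norm_l2E -[in X in _ -> X]E ltr_ofR.
move=> e0.
have e3 : 0 < e / 3 by rewrite divr_gt0.
have [x hx] := Fc _ e3.
apply: filterS (hx) => z hz.
have hyx : l2norm (L2 yP - x) <= 2 * (e / 3).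
  by apply: l2norm_le; [rewrite mulr_ge0// ltW|apply: key; last exact: filterS hx].
rewrite -(subrKA x); apply: le_lt_trans (l2normD _ _) _.
by move: hyx hz; lra.
Qed.

HB.instance Definition _ := Uniform_isComplete.Build l2 l2_complete.

End L2norm.

Section L2inner.
Variables (R : realType) (k : scalar_kind) (I : choiceType).
Local Notation K := (scalarField R k).
Local Notation l2 := (l2 R k I).
Local Existing Instance totally_filter.
Implicit Types (x y z : l2) (A B : {fset I}).

Lemma sum_absRM_le x y A :
  \sum_(i <- A) absR (x i) * absR (y i) <= energy x + energy y.
Proof.
apply: le_trans (lerD (sum_le_energy x A) (sum_le_energy y A)).
rewrite -big_split/= ler_sum// => i _.
have := sqr_ge0 (absR (x i) - absR (y i)).
by have := mulr_ge0 (absR_ge0 (x i)) (absR_ge0 (y i)); nra.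
Qed.

Lemma l2inner_subproof x y :
  exists s, sums_to (fun i => (x i : K) * conj (y i : K)) s.
Proof.
apply: (@sums_to_ex _ _ _ _ (energy x + energy y)) => A.
apply: le_trans (sum_absRM_le x y A).
by rewrite ler_sum// => i _; rewrite absRM absR_conj.
Qed.

Definition l2inner x y : K := projT1 (cid (l2inner_subproof x y)).

Lemma l2innerP x y : sums_to (fun i => (x i : K) * conj (y i : K)) (l2inner x y).
Proof. by rewrite /l2inner; case: cid. Qed.

Lemma l2inner_eq x y s :
  sums_to (fun i => (x i : K) * conj (y i : K)) s -> l2inner x y = s.
Proof. by move=> h; exact: sums_to_unique (@l2innerP x y) h. Qed.

Lemma l2inner_sym x y : l2inner x y = conj (l2inner y x).
Proof.
apply: l2inner_eq; apply: eq_sums_to (sums_to_conj (@l2innerP y x)) => i.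
by rewrite conjM conj_invol mulrC.
Qed.

Lemma l2innerDl x y z : l2inner (x + y) z = l2inner x z + l2inner y z.
Proof.
apply: l2inner_eq; apply: eq_sums_to (sums_toD (@l2innerP x z) (@l2innerP y z)) => i.
by rewrite l2D mulrDl.
Qed.

Lemma l2innerZl a x z : l2inner (a *: x) z = a * l2inner x z.
Proof.
apply: l2inner_eq; apply: eq_sums_to (sums_toZ (a := a) (@l2innerP x z)) => i.
by rewrite l2Z mulrA.
Qed.

Lemma l2innerDr x y z : l2inner x (y + z) = l2inner x y + l2inner x z.
Proof. by rewrite l2inner_sym l2innerDl conjD -!l2inner_sym. Qed.

Lemma l2innerZr a x z : l2inner x (a *: z) = conj a * l2inner x z.
Proof. by rewrite l2inner_sym l2innerZl conjM -l2inner_sym. Qed.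

Lemma l2inner_norm x : l2inner x x = `|x| ^+ 2.
Proof.
rewrite norm_l2E expr2 -ofRM -expr2 sqr_l2norm; apply: l2inner_eq.
by apply: eq_sums_to (@energyP _ _ _ x) => i; rewrite mul_conj.
Qed.

Let innerBl z : zmod_morphism (l2inner^~ z).
Proof. by move=> x y /=; rewrite l2innerDl -scaleN1r l2innerZl mulN1r. Qed.

Let innerBr z : zmod_morphism (l2inner z).
Proof.
move=> x y /=; rewrite l2innerDr -scaleN1r l2innerZr.
by rewrite conjN -(@ofR1 R k) conj_ofR ofR1 mulN1r.
Qed.

Let innerZl z : scalable_for *%R (l2inner^~ z).
Proof. by move=> a x; exact: l2innerZl. Qed.

Let innerZr z : scalable_for (conj \; *%R) (l2inner z).
Proof. by move=> a x; exact: l2innerZr. Qed.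

Let inner_hermitian x y : l2inner x y = (-1) ^+ false * conj (l2inner y x).
Proof. by rewrite mul1r -l2inner_sym. Qed.

Let inner_gt0 x : x != 0 -> 0 < l2inner x x.
Proof. by move=> x0; rewrite l2inner_norm exprn_gt0// normr_gt0. Qed.

HB.instance Definition _ :=
  isBilinear.Build K l2 l2 K *%R (conj \; *%R) l2inner innerBl innerBr innerZl innerZr.
HB.instance Definition _ :=
  isHermitianSesquilinear.Build K l2 false conj l2inner inner_hermitian.
HB.instance Definition _ := isDotProduct.Build K l2 l2inner inner_gt0.

Definition l2_hilbert : hilbertSpace R k :=
  @HilbertSpace R k (l2 : completeNormedModType K) l2inner l2inner_norm.

End L2inner.

(** * Weighted composition operators on l2(I) *)

Section WeightedComposition.
Variables (R : realType) (k : scalar_kind) (I : choiceType).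
Local Notation K := (scalarField R k).
Local Notation l2 := (l2 R k I).
Local Notation H := (l2_hilbert R k I).
Implicit Types (x y z : l2) (A B : {fset I}).

Lemma l2_insubdE (f : I -> K^o) : f \in @sq_summable R k I ->
  forall i, (insubd (0 : l2) f) i = f i.
Proof. by move=> fP i; rewrite /insubd insubT. Qed.

Lemma l2_point (i0 : I) : exists x : l2, x i0 = 1.
Proof.
pose f i : K^o := if i == i0 then 1 else 0.
have fP : f \in @sq_summable R k I.
  apply/sq_summableP; exists (absR (1 : K) ^+ 2) => A.
  have z i : i != i0 -> absR (f i : K) ^+ 2 = 0.
    by rewrite /f => /negPf ->; rewrite absR0 expr0n.
  have [iA|iA] := boolP (i0 \in A); last first.
    rewrite big_seq big1 ?sqr_ge0// => i iA'; apply: z.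
    by apply: contraNneq iA => <-.
  rewrite (big_fsetD1 i0)//= big_seq big1 ?addr0 => [|i]; first by rewrite /f eqxx.
  by rewrite in_fsetD1 => /andP[/z ->].
by exists (L2 fP); rewrite /= /f eqxx.
Qed.

(** Used for strict positivity: an inner product whose terms are nonnegative
    reals vanishes only if they all do. *)
Lemma l2inner_nneg x y (g : I -> R) : (forall i, 0 <= g i) ->
  (forall i, (x i : K) * conj (y i : K) = ofR k (g i)) ->
  forall i, ofR k (g i) <= l2inner x y.
Proof.
move=> g0 gE i; have gM A : \sum_(j <- A) g j <= energy x + energy y.
  apply: le_trans (sum_absRM_le x y A); rewrite ler_sum// => j _.
  by rewrite -(absR_conj (y j)) -absRM gE absR_ofR ger0_norm.
have [s [sg gs _]] := sums_to_ge0 k g0 gM.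
rewrite (_ : l2inner x y = ofR k s).
  by have := gs [fset i]%fset; rewrite big_seq_fset1 ler_ofR.
by apply: l2inner_eq; apply: eq_sums_to sg => j; rewrite gE.
Qed.

(** The value 0 is taken where the weighted family fails to be square summable;
    for bounded weights and injective phi this does not happen ([wcompE]). *)
Definition wcomp (a : I -> R) (phi : I -> I) x : l2 :=
  insubd (0 : l2) (fun i => ofR k (a i) * (x (phi i) : K)).

Lemma wcomp_sum_le (a : I -> R) (phi : I -> I) (C : R) x A : injective phi ->
  (forall i, `|a i| <= C) ->
  \sum_(i <- A) absR (ofR k (a i) * (x (phi i) : K)) ^+ 2 <= C ^+ 2 * energy x.
Proof.
move=> phi_inj aC.
apply: le_trans (ler_wpM2l (sqr_ge0 C) (sum_le_energy x [fset phi i | i in A]%fset)).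
rewrite mulr_sumr big_imfset/=; last by move=> i j _ _; exact: phi_inj.
rewrite ler_sum// => i _; rewrite -exprMn absRM absR_ofR.
rewrite ler_sqr ?nnegrE ?mulr_ge0 ?absR_ge0//; last exact: le_trans (aC i).
by rewrite ler_wpM2r ?absR_ge0.
Qed.

Lemma wcompE (C : R) a phi x i : injective phi -> (forall i, `|a i| <= C) ->
  wcomp a phi x i = ofR k (a i) * (x (phi i) : K).
Proof.
move=> phi_inj aC; apply: l2_insubdE; apply/sq_summableP.
by exists (C ^+ 2 * energy x) => A; exact: wcomp_sum_le.
Qed.

Lemma wcomp_norm (C : R) a phi x : injective phi -> (forall i, `|a i| <= C) ->
  l2norm (wcomp a phi x) <= C * l2norm x.
Proof.
move=> phi_inj aC; have [[i _]|I0] := pselect (exists i : I, True); last first.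
  have -> : wcomp a phi x = 0 by apply: l2P => i; case: I0; exists i.
  have -> : x = 0 by apply: l2P => i; case: I0; exists i.
  by rewrite -re_norm_l2 normr0 -(ofR0 R k) re_ofR mulr0.
have C0 : 0 <= C by exact: le_trans (aC i).
apply: l2norm_le => [|A]; first by rewrite mulr_ge0 ?l2norm_ge0.
rewrite exprMn sqr_l2norm; apply: le_trans (wcomp_sum_le x A phi_inj aC).
by rewrite ler_sum// => j _; rewrite (wcompE _ _ phi_inj aC).
Qed.

Lemma wcomp_linear (C : R) a phi : injective phi -> (forall i, `|a i| <= C) ->
  linear (wcomp a phi).
Proof.
move=> phi_inj aC t x y; apply: l2P => i.
by rewrite l2D l2Z !(wcompE _ _ phi_inj aC) l2D l2Z; ring.
Qed.

Lemma wcomp_bounded (C : R) a phi : injective phi -> (forall i, `|a i| <= C) ->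
  @bounded_op R k H (wcomp a phi).
Proof.
move=> phi_inj aC; split; first exact: wcomp_linear phi_inj aC.
by exists C => x; rewrite /nrm !re_norm_l2; exact: wcomp_norm.
Qed.

Lemma wcomp_inner (C : R) a phi psi x y : cancel phi psi -> cancel psi phi ->
  (forall i, `|a i| <= C) ->
  l2inner (wcomp a phi x) y = l2inner x (wcomp (a \o psi) psi y).
Proof.
move=> c1 c2 aC; apply/esym/l2inner_eq.
apply: eq_sums_to (sums_to_reindex c2 c1 (@l2innerP _ _ _ (wcomp a phi x) y)) => i /=.
rewrite (wcompE _ _ (can_inj c1) aC) (wcompE _ _ (can_inj c2) (fun i => aC (psi i))).
by rewrite /= c2 conjM conj_ofR; ring.
Qed.

End WeightedComposition.

(** * Maximal definite subspaces for the exchange operator *)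

Section KreinPair.
Variables (R : realType) (k : scalar_kind) (I : choiceType).
Variables (sw : I -> I) (rho : I -> R).
Hypotheses (swK : involutive sw) (rho_gt0 : forall i, 0 < rho i).
Local Notation K := (scalarField R k).
Local Notation l2 := (l2 R k I).
Local Notation H := (l2_hilbert R k I).
Implicit Types (x y z v : l2) (A B : {fset I}).

Definition swap : l2 -> l2 := wcomp (fun=> 1) sw.

Let sw_inj : injective sw. Proof. exact: inv_inj. Qed.

Let one_le (i : I) : `|1 : R| <= 1. Proof. by rewrite normr1. Qed.

Lemma swapE x i : swap x i = x (sw i).
Proof. by rewrite /swap (wcompE _ _ sw_inj one_le) ofR1 mul1r. Qed.

Lemma swapK : involutive swap.
Proof. by move=> x; apply: l2P => i; rewrite !swapE swK. Qed.

Lemma swap_bounded : @bounded_op R k H swap.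
Proof. exact: wcomp_bounded sw_inj one_le. Qed.

Lemma swap_inner x y : l2inner (swap x) y = l2inner x (swap y).
Proof. exact: wcomp_inner swK swK one_le. Qed.

Lemma l2norm_swap x : l2norm (swap x) = l2norm x.
Proof.
have le z : l2norm (swap z) <= l2norm z.
  by rewrite -[leRHS]mul1r; exact: wcomp_norm sw_inj one_le.
by apply/eqP; rewrite eq_le le/= -{1}(swapK x) le.
Qed.

(** For sigma = 1 or -1, this is the graph of sigma times a positive diagonal
    operator; the symmetric form treats the two copies alike and makes the graph
    closed even when the operator or its inverse is unbounded. *)
Definition graph (sigma : R) : set l2 :=
  [set v | forall i, ofR k (rho (sw i)) * (v i : K) = ofR k (sigma * rho i) * v (sw i)].

Lemma graph_closed_submod sigma : @closed_submod R k H (graph sigma).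
Proof.
have sub : submod_closed (mem (graph sigma) : {pred l2}).
  split=> [|a x y]; first by rewrite inE => i; rewrite !l20 !mulr0.
  rewrite !inE => hx hy i.
  by rewrite !l2D !l2Z !mulrDr mulrCA hx hy; ring.
split; first exact: sub.
move=> v cv i /=; apply/eqP; rewrite -subr_eq0 -absR_eq0; apply/eqP.
set d := absR _; apply/eqP; rewrite eq_le absR_ge0 andbT leNgt; apply/negP => d0.
pose C := rho (sw i) + `|sigma| * rho i.
have C0 : 0 < C by rewrite ltr_pwDl// mulr_ge0// ltW.
have dC : 0 < ofR k (d / C) by rewrite -(ofR0 R k) ltr_ofR divr_gt0.
have [q [gq]] := cv _ (nbhsx_ballx (v : H) _ dC).
rewrite -ball_normE /ball_/= norm_l2E ltr_ofR ltr_pdivlMr// => hq.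
suff : d <= l2norm (v - q) * C by rewrite leNgt hq.
have -> : d = absR (ofR k (rho (sw i)) * ((v - q) i : K) -
                    ofR k (sigma * rho i) * ((v - q) (sw i))).
  by rewrite /d; congr absR; rewrite !l2D !l2N !mulrBr gq; ring.
apply: le_trans (absRD _ _) _; rewrite absRN !absRM !absR_ofR normrM.
rewrite !(gtr0_norm (rho_gt0 _)) mulrC /C mulrDr; apply: lerD.
  by rewrite ler_wpM2r ?absR_le_l2norm// ltW.
by rewrite mulrC ler_wpM2r ?absR_le_l2norm ?mulr_ge0// ltW.
Qed.

Section Sign.
Variable sigma : R.
Hypothesis sigma2 : sigma * sigma = 1.

Lemma graph_swap v i : graph sigma v ->
  v (sw i) = ofR k (sigma * (rho (sw i) / rho i)) * v i.
Proof.
move=> gv; have r0 : ofR k (rho i) != 0.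
  by rewrite -absR_eq0 absR_ofR normr_eq0 gt_eqF.
apply: (mulfI r0); rewrite [RHS]mulrA -ofRM.
have -> : rho i * (sigma * (rho (sw i) / rho i)) = sigma * rho (sw i).
  by field; rewrite gt_eqF.
by rewrite ofRM -[RHS]mulrA gv [RHS]mulrA -ofRM [sigma * _]mulrA sigma2 mul1r.
Qed.

Lemma graph_definite v : graph sigma v -> v != 0 ->
  0 < ofR k sigma * l2inner v (swap v).
Proof.
move=> gv vn0; have [i vi] : exists i, (v i : K) != 0.
  apply: contrapT => no; case/eqP: vn0; apply: l2P => i; rewrite l20.
  by apply: contrapT => /eqP vi; apply: no; exists i.
have -> : ofR k sigma * l2inner v (swap v) = l2inner v (ofR k sigma *: swap v).
  by rewrite l2innerZr conj_ofR.
pose g i := rho (sw i) / rho i * absR (v i : K) ^+ 2.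
have g0 j : 0 <= g j by rewrite mulr_ge0 ?sqr_ge0// divr_ge0// ltW.
apply: lt_le_trans (l2inner_nneg (g := g) g0 _ i).
  by rewrite -(ofR0 R k) ltr_ofR mulr_gt0 ?divr_gt0// exprn_gt0// lt_def absR_eq0 vi absR_ge0.
move=> j; rewrite l2Z swapE (graph_swap j gv) !conjM !conj_ofR /g.
rewrite [RHS]ofRM -mul_conj [ofR k sigma * _]mulrA -ofRM [sigma * _]mulrA sigma2 mul1r.
by rewrite mulrCA.
Qed.

(** Let u be the vector of the graph with u + sigma * J u = v + sigma * J v.
    Then J (v - u) = - sigma (v - u), so the form multiplied by sigma is
    - |v - u|^2 there; as v - u lies in the larger subspace L, it vanishes. *)
Lemma graph_maximal (L : set l2) : @closed_submod R k H L ->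
  (forall v, L v -> v != 0 -> 0 < ofR k sigma * l2inner v (swap v)) ->
  graph sigma `<=` L -> L `<=` graph sigma.
Proof.
move=> [[_ Lsub] _] Lpos gL v Lv.
(* With a = rho i / D i, the weights a and 1 - a at i and sw i are bounded, so
   u is square summable however large the ratio of the rho is. *)
pose D i := rho i + rho (sw i).
have D0 i : 0 < D i by rewrite addr_gt0.
have al i : `|rho i / D i| <= 1.
  by rewrite ger0_norm ?divr_ge0 ?ltW// ltr_pdivrMr// mul1r ltrDl.
pose u := wcomp (fun i => rho i / D i) id (v + ofR k sigma *: swap v).
have uE i : u i = ofR k (rho i / D i) * (v i + ofR k sigma * v (sw i)).
  by rewrite /u (wcompE _ _ (@inj_id I) al) l2D l2Z swapE.
have Dsw i : D (sw i) = D i by rewrite /D swK addrC.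
have ss : ofR k sigma * ofR k sigma = 1 by rewrite -ofRM sigma2 ofR1.
have gu : graph sigma u.
  move=> i; rewrite !uE swK Dsw !ofRM.
  set a := ofR k sigma in ss *; set p := ofR k (rho i); set q := ofR k (rho (sw i)).
  by transitivity (q * (p * ofR k (D i)^-1 * (v i * (a * a) + a * v (sw i))));
    [rewrite ss mulr1|ring].
pose d : l2 := v - u.
have Jd : swap d = ofR k (- sigma) *: d.
  apply: l2P => i; rewrite swapE l2Z !l2D !l2N !uE swK Dsw.
  have n0 : ofR k (D i) != 0 by rewrite -absR_eq0 absR_ofR normr_eq0 gt_eqF.
  have e1 : ofR k (rho (sw i) / D i) = 1 - ofR k (rho i / D i).
    by rewrite -(ofR1 R k) -ofRN -ofRD; congr ofR; rewrite /D; field; rewrite gt_eqF// addr_gt0.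
  rewrite e1 ofRN; set t := ofR k (rho i / D i); set a := ofR k sigma in ss *.
  move: (v i : K) (v (sw i) : K) => P Q.
  by transitivity (t * Q * (a * a) - a * P + a * t * P); [rewrite ss; ring|ring].
have Ld : L d.
  have /= := Lsub (-1) u v; rewrite !inE /d addrC scaleN1r; apply => //.
  exact: gL.
have d0 : d = 0.
  apply: contrapT => /eqP dn0; have := Lpos d Ld dn0.
  rewrite Jd l2innerZr conj_ofR mulrA -ofRM mulrN sigma2 l2inner_norm.
  by rewrite ofRN ofR1 mulN1r oppr_gt0 => /(le_lt_trans (exprn_ge0 2 (normr_ge0 _))); rewrite ltxx.
by have -> : v = u by apply/eqP; rewrite -subr_eq0; apply/eqP.
Qed.
End Sign.

(** The terms of the inner product at i and at sw i are opposite. *)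
Lemma graph_orthogonal x y : graph 1 x -> graph (-1) y -> l2inner x (swap y) = 0.
Proof.
move=> gx gy; have h := @l2innerP _ _ _ x (swap y).
have h2 := sums_to_reindex swK swK h.
have e : l2inner x (swap y) = - l2inner x (swap y).
  apply: l2inner_eq; apply: eq_sums_to (sums_toN h2) => i /=; rewrite !swapE swK.
  have p0 : rho i != 0 by rewrite gt_eqF.
  have q0 : rho (sw i) != 0 by rewrite gt_eqF.
  rewrite (@graph_swap 1 _ x i gx) ?mulr1// (@graph_swap (-1) _ y i gy) ?mulrNN ?mulr1//.
  rewrite mul1r mulN1r conjM conj_ofR ofRN; ring.
have /eqP : l2inner x (swap y) *+ 2 = 0 by rewrite mulr2n {1}e addNr.
by rewrite mulrn_eq0 => /eqP.
Qed.

(** A vector p is first cut off to v, supported in a finite set invariant under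
    sw.  With z i = (rho i / rho (sw i)) v (sw i), the halves of v + z and v - z
    lie in the two graphs; the cut-off keeps z square summable. *)
Lemma graph_dense : @dense H [set x + y | x in graph 1 & y in graph (-1)].
Proof.
move=> O [p Op] oO; have [_e /= e0 eO] := (nbhs_ballP p O).1 (oO p Op).
have E := ofR_re (ltW e0); set e := re _e in E.
have {}e0 : 0 < e by rewrite -(ltr_ofR k) E ofR0.
have e2 : 0 < e ^+ 2 by rewrite exprn_gt0.
have [A hA] := energy_approx p e2.
pose inA i := (i \in A) || (sw i \in A).
have inA_sw i : inA (sw i) = inA i by rewrite /inA swK orbC.
pose chi i : R := (inA i)%:R.
have chi1 i : `|chi i| <= 1 by rewrite /chi; case: (inA i); rewrite ?normr1 ?normr0.
pose a i := chi i * (rho i / rho (sw i)).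
pose A' := (A `|` [fset sw i | i in A])%fset.
have inA' i : inA i -> i \in A'.
  rewrite in_fsetU => /orP[->//|iA]; apply/orP; right.
  by rewrite -(swK i); exact: in_imfset.
have aC i : `|a i| <= \sum_(j <- A') (rho j / rho (sw j)).
  have sum0 B : 0 <= \sum_(j <- B) (rho j / rho (sw j)).
    by rewrite sumr_ge0// => j _; rewrite divr_ge0// ltW.
  rewrite /a /chi; have [iA|_] := boolP (inA i); last by rewrite mul0r normr0 sum0.
  rewrite mul1r ger0_norm ?divr_ge0 ?(ltW (rho_gt0 _))// (big_fsetD1 i) ?inA'//=.
  by rewrite lerDl sum0.
pose v := wcomp chi id p; pose z := wcomp a sw p.
have vE i : v i = ofR k (chi i) * p i by rewrite /v (wcompE _ _ (@inj_id I) chi1).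
have zE i : z i = ofR k (a i) * p (sw i) by rewrite /z (wcompE _ _ sw_inj aC).
have chi_sw i : chi (sw i) = chi i by rewrite /chi inA_sw.
have q1 i : rho (sw i) * a i = rho i * chi i.
  by rewrite /a; field; rewrite gt_eqF.
have hg (s : R) : s * s = 1 -> graph s (ofR k 2^-1 *: (v + ofR k s *: z)).
  move=> ss i; rewrite !l2Z !l2D !l2Z !vE !zE swK chi_sw.
  have h1 : ofR k (rho (sw i)) * ofR k (a i) = ofR k (rho i) * ofR k (chi i).
    by rewrite -!ofRM q1.
  have h2 : ofR k (rho i) * ofR k (a (sw i)) = ofR k (rho (sw i)) * ofR k (chi i).
    by rewrite -!ofRM -{1}(swK i) q1 chi_sw.
  have h3 : ofR k s * ofR k s = 1 by rewrite -ofRM ss ofR1.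
  rewrite [ofR k (s * _)]ofRM.
  move: (ofR k 2^-1) (ofR k s) (p i : K) (p (sw i) : K) h1 h2 h3 => t b P Q h1 h2 h3.
  transitivity (t * (ofR k (rho (sw i)) * ofR k (chi i) * P +
     b * (ofR k (rho (sw i)) * ofR k (a i)) * Q)); first by ring.
  rewrite h1 -h2; transitivity (t * (b * (ofR k (rho i) * ofR k (chi i)) * Q +
     (b * b) * (ofR k (rho i) * ofR k (a (sw i))) * P)); last by ring.
  by rewrite h3; ring.
exists v; split.
  apply: eO; rewrite -ball_normE /ball_/= norm_l2E -E ltr_ofR.
  rewrite -ltr_sqr ?nnegrE ?l2norm_ge0 ?(ltW e0)// sqr_l2norm.
  apply: le_lt_trans (_ : energy p - \sum_(i <- A) absR (p i) ^+ 2 < _); last first.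
    by move: hA; lra.
  apply: energy_le => B; rewrite lerBrDr.
  apply: le_trans (sum_le_energy p (A `|` B)%fset).
  rewrite -lerBrDr sum_fset_sub ?fsubsetUl//.
  have pv i : absR ((p - v) i) ^+ 2 <= absR (p i : K) ^+ 2 /\
      (inA i -> absR ((p - v) i) ^+ 2 = 0).
    rewrite l2D l2N vE /chi; case: (inA i); rewrite ?ofR1 ?ofR0.
      by rewrite mul1r subrr absR0 expr0n/= sqr_ge0.
    by rewrite mul0r subr0.
  apply: (@le_trans _ _ (\sum_(i <- (A `|` B)%fset) absR ((p - v) i) ^+ 2)).
    rewrite -subr_ge0 sum_fset_sub ?fsubsetUr// sumr_ge0// => i _.
    exact: sqr_ge0.
  have A0 : \sum_(i <- A) absR ((p - v) i) ^+ 2 = 0.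
    rewrite big_seq big1// => i iA; have [_] := pv i; apply.
    by apply/orP; left; exact: iA.
  have := sum_fset_sub (fun i => absR ((p - v) i) ^+ 2) (fsubsetUl A B).
  rewrite A0 subr0 => ->.
  by rewrite ler_sum// => i _; have [] := pv i.
exists (ofR k 2^-1 *: (v + ofR k 1 *: z)); first by apply: hg; rewrite mulr1.
exists (ofR k 2^-1 *: (v + ofR k (-1) *: z)); first by apply: hg; rewrite mulrNN mulr1.
apply: l2P => i; rewrite !(l2D, l2Z) ofRN ofR1.
have t2 : ofR k (2^-1 : R) + ofR k 2^-1 = 1.
  by rewrite -ofRD -(ofR1 R k); congr ofR; lra.
transitivity ((ofR k 2^-1 + ofR k 2^-1) * v i); last by rewrite t2 mul1r.
by ring.
Qed.
End KreinPair.

(** * The weighted shift *)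

Section WeightedShift.
Variables (R : realType) (k : scalar_kind) (c : R) (g : nat -> R).
Hypothesis c_ge1 : 1 <= c.
Hypothesis g_gt0 : forall n, 0 < g n.
Hypothesis g_env : forall p q,
  g (p + q)%N <= envelope c q * g p /\ g p <= envelope c q * g (p + q)%N.
Hypothesis g_wild : forall (b : bool) (M : R) n0,
  exists n, (n0 <= n)%N /\ M * c ^+ n < orient b (g n).

Local Notation I := (int * bool)%type.
Local Notation K := (scalarField R k).
Local Notation l2 := (l2 R k I).
Local Notation H := (l2_hilbert R k I).
Implicit Types (i : I) (m : int) (x y : l2).

Definition flip i : I := (i.1, ~~ i.2).
Definition slide m i : I := (i.1 - m, i.2).
Definition rho i : R := orient i.2 (g `|i.1|%N).

Lemma flipK : involutive flip.
Proof. by case=> n b; rewrite /flip/= negbK. Qed.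

Lemma slideK m : cancel (slide m) (slide (- m)).
Proof. by case=> n b; rewrite /slide/= opprK subrK. Qed.

Lemma slideNK m : cancel (slide (- m)) (slide m).
Proof. by case=> n b; rewrite /slide/= opprK addrK. Qed.

Lemma slideD m p i : slide p (slide m i) = slide (m + p) i.
Proof. by rewrite /slide/= opprD addrA. Qed.

Lemma rho_gt0 i : 0 < rho i.
Proof. exact: orient_gt0. Qed.

Lemma rho_flip i : rho (flip i) = (rho i)^-1.
Proof. by rewrite /rho /flip; case: i => n [] /=; rewrite ?invrK. Qed.

Let env_gt0 n : 0 < envelope c n. Proof. exact: envelope_gt0. Qed.

Lemma rho_ratio m i : `|rho i / rho (slide m i)| <= envelope c `|m|%N.
Proof.
have gle (p q d : nat) : (p <= q + d)%N -> (q <= p + d)%N -> g p <= envelope c d * g q.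
  move=> pq qp; have mono e : (e <= d)%N -> envelope c e <= envelope c d.
    by move=> /subnKC <-; exact: envelope_incr.
  case: (leqP p q) => [le|/ltnW le].
    have [_] := g_env p (q - p); rewrite subnKC// => h; apply: le_trans h _.
    by rewrite ler_pM2r// mono// leq_subLR.
  have [h _] := g_env q (p - q); rewrite subnKC// in h; apply: le_trans h _.
  by rewrite ler_pM2r// mono// leq_subLR.
rewrite gtr0_norm ?divr_gt0 ?rho_gt0// ler_pdivrMr ?rho_gt0//.
case: i => n [] /=; rewrite /rho /slide/=.
  by apply: gle; lia.
rewrite ler_pdivlMr// mulrC ler_pdivrMr//.
by apply: gle; lia.
Qed.

Definition shift m : l2 -> l2 := wcomp (fun i => rho i / rho (slide m i)) (slide m).

Lemma shiftE m x i : shift m x i = ofR k (rho i / rho (slide m i)) * (x (slide m i) : K).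
Proof. exact: (wcompE _ _ (can_inj (slideK m)) (rho_ratio m)). Qed.

Lemma shift_linear m : linear (shift m).
Proof. exact: (wcomp_linear (can_inj (slideK m)) (rho_ratio m)). Qed.

Lemma shift_norm m x : l2norm (shift m x) <= envelope c `|m|%N * l2norm x.
Proof. exact: (wcomp_norm _ (can_inj (slideK m)) (rho_ratio m)). Qed.

Lemma shift_bounded m : @bounded_op R k H (shift m).
Proof. exact: (@wcomp_bounded R k _ _ _ _ (can_inj (slideK m)) (rho_ratio m)). Qed.

Lemma shift0 x : shift 0 x = x.
Proof.
apply: l2P => i; rewrite shiftE (_ : slide 0 i = i); last first.
  by rewrite /slide subr0; case: i.
by rewrite divff ?ofR1 ?mul1r// gt_eqF// rho_gt0.
Qed.

Lemma shiftD m p x : shift (m + p) x = shift m (shift p x).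
Proof.
apply: l2P => i; rewrite !shiftE slideD mulrA -ofRM; congr (ofR k _ * _).
by field; rewrite !gt_eqF// rho_gt0.
Qed.

Lemma shiftK m : cancel (shift m) (shift (- m)).
Proof. by move=> x; rewrite -shiftD addNr shift0. Qed.

Lemma shiftNK m : cancel (shift (- m)) (shift m).
Proof. by move=> x; rewrite -shiftD addrN shift0. Qed.

Lemma iter_shift N m x : iter N (shift m) x = shift (m * N%:Z) x.
Proof.
elim: N => [|N IH]; first by rewrite mulr0 shift0.
by rewrite iterS IH -shiftD intS mulrDr mulr1.
Qed.

Local Notation J := (swap (k := k) flip).

(** The adjoint of a weighted translation by m is a translation by - m with the
    inverse ratios of rho, and J turns rho into its inverse. *)
Lemma shift_adjoint m x y : l2inner (shift m x) y = l2inner x (J (shift (- m) (J y))).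
Proof.
rewrite (wcomp_inner x y (slideK m) (slideNK m) (rho_ratio m)); congr l2inner.
apply: l2P => i; rewrite (swapE flipK) shiftE (swapE flipK).
have aC j : `|((fun i => rho i / rho (slide m i)) \o slide (- m)) j| <= envelope c `|m|%N.
  exact: rho_ratio.
rewrite (wcompE _ _ (can_inj (slideNK m)) aC) /= slideNK.
have -> : slide (- m) (flip i) = flip (slide (- m) i) by [].
by rewrite flipK !rho_flip invrK [X in _ = ofR k X * _]mulrC.
Qed.

Definition unit_step m := m = 1 \/ m = -1.

(** If x (n, b) is not zero, the coordinate (n + m N, b) of the N-th power applied
    to x is proportional to rho (n + m N, b), and rho (_, b) is not dominated by
    any multiple of c ^+ N in either direction. *)
Lemma shift_Sset m : unit_step m -> @Sset R k H (shift m) c = [set 0].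
Proof.
have c0 : 0 < c by exact: lt_le_trans c_ge1.
move=> m1; apply/seteqP; split=> [x [M M0 hM] /=|_ ->]; last first.
  exists 0 => // N; rewrite mul0r iter_shift.
  have -> : shift (m * N%:Z) (0 : l2) = (0 : l2).
    by apply: l2P => i; rewrite shiftE !l20 mulr0.
  by rewrite nrm0.
apply: l2P => -[n b]; apply/eqP; rewrite l20; apply/negPn/negP => xn0.
have xp : 0 < absR (x (n, b)) by rewrite lt_def absR_eq0 xn0 absR_ge0.
(* The factor c ^+ `|n| accounts for N being as large as p + `|n|. *)
pose M' := M * rho (n, b) / absR (x (n, b)) * c ^+ `|n|%N.
have [p [np hp]] := g_wild b M' `|n|%N.
have [N [nN Np]] : exists N : nat, absz ((n : int) + m * N%:Z) = p /\ (N <= p + `|n|)%N.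
  case: m1 => ->; [exists (absz (p%:Z - n))|exists (absz (p%:Z + n))]; lia.
have := hM N; rewrite iter_shift /nrm re_norm_l2.
have := absR_le_l2norm (shift (m * N%:Z) x) (n + m * N%:Z, b).
rewrite shiftE /slide/= addrK absRM absR_ofR gtr0_norm ?divr_gt0 ?rho_gt0//.
move=> h1 h2; have := le_trans h1 h2; apply/negP; rewrite -ltNge.
rewrite mulrAC ltr_pdivlMr ?rho_gt0// -ltr_pdivrMr//.
rewrite {2}/rho /= nN; apply: le_lt_trans hp.
rewrite /M'.
have -> : M * c ^+ N * rho (n, b) / absR (x (n, b)) =
          M * rho (n, b) / absR (x (n, b)) * c ^+ N by field; rewrite gt_eqF.
rewrite -[leRHS]mulrA ler_wpM2l ?divr_ge0 ?mulr_ge0 ?absR_ge0 ?(ltW (rho_gt0 _))//.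
by rewrite -exprD ler_weXn2l// addnC.
Qed.

Lemma shift_conj_Sset m : unit_step m -> @Sset R k H (J \o shift m \o J) c = [set 0].
Proof.
move=> m1; have it N x : iter N (J \o shift m \o J) x = J (iter N (shift m) (J x)).
  elim: N => [|N IH] /=; first by rewrite (swapK flipK).
  by rewrite IH /= (swapK flipK).
have J0 : J (0 : l2) = (0 : l2) by apply: l2P => i; rewrite (swapE flipK) !l20.
have E x : @Sset R k H (J \o shift m \o J) c x <-> @Sset R k H (shift m) c (J x).
  by split=> -[M M0 hM]; exists M => // N; have := hM N;
    rewrite it /nrm !re_norm_l2 (l2norm_swap flipK).
apply/seteqP; split=> x; first by move/E; rewrite shift_Sset//= => h; rewrite -(swapK flipK x) h.
by move=> ->; apply/E; rewrite J0 shift_Sset.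
Qed.

Lemma shift_graph m (sigma : R) : @invariant_under R k H (shift m) (graph flip rho sigma).
Proof.
move=> _ [v gv <-] i; rewrite !shiftE.
have -> : slide m (flip i) = flip (slide m i) by [].
have := gv (slide m i); move: (slide m i) => j gvj.
have -> : rho i / rho j = rho i * rho (flip j) by rewrite rho_flip.
have -> : rho (flip i) / rho (flip j) = rho (flip i) * rho j by rewrite !rho_flip invrK.
transitivity (ofR k (rho (flip i) * rho i) * (ofR k (rho (flip j)) * (v j : K))).
  by rewrite !ofRM; ring.
by rewrite gvj !ofRM; ring.
Qed.

Lemma shift_specradius m (L : set H) : unit_step m ->
  closed_submod L -> L <> [set 0] -> @invariant_under R k H (shift m) L ->
  @specradius_on R k H L (shift m) = c.
Proof.
move=> m1; apply: specradius_onE => //; first exact: shift_linear.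
  move=> N x; rewrite iter_shift /nrm !re_norm_l2.
  have {2}-> : N = absz (m * N%:Z) by case: m1 => ->; lia.
  exact: shift_norm.
exact: shift_Sset.
Qed.
End WeightedShift.

(** * The theorem *)

Theorem theorem1 (R : realType) (k : scalar_kind) (c : R) (c_ge1 : 1 <= c) :
  exists (H : hilbertSpace R k) (J V : H -> H),
    [/\ bounded_op J, adjoint J = J & forall x, J (J x) = x] /\
    Junitary J V /\
    (* (a) *)
    (specradius V = c /\ specradius (inverse V) = c) /\
    (* (b) *)
    [/\ Sset V c = [set 0], Sset (inverse V) c = [set 0],
        Sset (inverse (adjoint V)) c = [set 0] &
        Sset (adjoint V) c = [set 0]] /\
    (* (c) *)
    (exists Lp Lm : set H,
      [/\ maximal_for (strictly_positive J) Lp,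
          maximal_for (strictly_negative J) Lm,
          invariant_under V Lp /\ invariant_under (inverse V) Lp,
          invariant_under V Lm /\ invariant_under (inverse V) Lm &
          Jorthogonal J Lp Lm /\
          dense [set x + y | x in Lp & y in Lm]]) /\
    (* (d1) *)
    (forall L1 : set H, closed_submod L1 -> L1 <> [set 0] ->
      invariant_under V L1 -> specradius_on L1 V = specradius V) /\
    (* (d2) *)
    (forall L2 : set H, closed_submod L2 -> L2 <> [set 0] ->
      invariant_under (inverse V) L2 ->
      specradius_on L2 (inverse V) = specradius (inverse V)).
Proof.
have [g [g_gt0 g_env g_wild]] := zigzag_weight c_ge1.
pose I := (int * bool)%type.
pose H := l2_hilbert R k I.
pose J : H -> H := swap flip.
pose V : int -> H -> H := shift g.
pose G (s : R) : set H := graph flip (rho g) s.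
have ss1 : (1 : R) * 1 = 1 by rewrite mulr1.
have ssN : (-1 : R) * (-1) = 1 by rewrite mulrNN mulr1.
have rho0 := rho_gt0 g_gt0.
have step1 : unit_step 1 by left.
have stepN : unit_step (-1) by right.
have VK m : cancel (V m) (V (- m)) by exact: shiftK c_ge1 g_gt0 g_env m.
have VNK m : cancel (V (- m)) (V m) by exact: shiftNK c_ge1 g_gt0 g_env m.
have JK : involutive J := swapK flipK.
have invV : inverse (V 1) = V (-1) by apply: inverse_eq.
have adjV : adjoint (V 1) = J \o V (-1) \o J.
  by apply: adjoint_eq => x y; exact: shift_adjoint c_ge1 g_gt0 g_env _ _ _.
have invA : inverse (adjoint (V 1)) = J \o V 1 \o J.
  by rewrite adjV; apply: inverse_eq => x /=; rewrite JK ?VK ?VNK JK.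
have spec m L : unit_step m -> closed_submod L -> L <> [set 0] ->
    invariant_under (V m) L -> specradius_on L (V m) = c.
  by move=> m1; exact: (shift_specradius c_ge1 g_gt0 g_env g_wild).
have full m : unit_step m -> specradius (V m) = c.
  move=> m1; apply: spec => //.
  - split; last exact: closedT.
    by split=> [|a u v _ _]; rewrite inE.
  - have [x x1] := l2_point R k ((0, true) : I).
    move=> e; have : [set: H] x by []; rewrite e => /= x0.
    by move/eqP: x1; rewrite x0 l20 eq_sym oner_eq0.
exists H, J, (V 1); rewrite invV invA adjV.
split; first split.
- exact: swap_bounded flipK.
- by apply: adjoint_eq => x y; exact: (swap_inner flipK).
- exact: JK.
split; first split.
- exact: (shift_bounded k c_ge1 g_gt0 g_env).
- by exists (V (-1)); [exact: VK|exact: VNK].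
- by rewrite invV; exact: (shift_bounded k c_ge1 g_gt0 g_env).
- move=> x y; rewrite /Jform.
  have -> : inner H (V 1 x) (J (V 1 y)) = inner H x (J (V (-1) (J (J (V 1 y))))).
    exact: shift_adjoint c_ge1 g_gt0 g_env _ _ _.
  by rewrite JK VK.
split; first by rewrite !full.
split; first split.
- exact: (shift_Sset k c_ge1 g_gt0 g_env g_wild).
- exact: (shift_Sset k c_ge1 g_gt0 g_env g_wild).
- exact: (shift_conj_Sset k c_ge1 g_gt0 g_env g_wild).
- exact: (shift_conj_Sset k c_ge1 g_gt0 g_env g_wild).
split; last first.
  split=> L Lsub L0 LV; rewrite full//; exact: spec.
have definite s v : s * s = 1 -> G s v -> v != 0 -> 0 < ofR k s * Jform J v v.
  by move=> ss gv v0; exact: (graph_definite flipK rho0 ss gv v0).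
have maximal s L : s * s = 1 -> closed_submod L ->
    (forall v, L v -> v != 0 -> 0 < ofR k s * Jform J v v) -> ~ (G s `<` L).
  move=> ss Lsub Lpos [sub nsub]; apply: nsub.
  exact: (graph_maximal flipK rho0 ss Lsub Lpos sub).
exists (G 1), (G (-1)); split.
- split; first split.
  + exact: (graph_closed_submod k flip rho0).
  + by move=> v gv v0; have := definite 1 v ss1 gv v0; rewrite ofR1 mul1r.
  + move=> L [Lsub Lpos]; apply: maximal => // v Lv v0.
    by rewrite ofR1 mul1r; exact: Lpos.
- split; first split.
  + exact: (graph_closed_submod k flip rho0).
  + move=> v gv v0; have := definite (-1) v ssN gv v0.
    by rewrite ofRN ofR1 mulN1r oppr_gt0.
  + move=> L [Lsub Lpos]; apply: maximal => // v Lv v0.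
    by rewrite ofRN ofR1 mulN1r oppr_gt0; exact: Lpos.
- by split; exact: (shift_graph c_ge1 g_gt0 g_env).
- by split; exact: (shift_graph c_ge1 g_gt0 g_env).
- split; last exact: (graph_dense flipK rho0).
  by move=> x y gx gy; exact: (graph_orthogonal flipK rho0 gx gy).
Qed.
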